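(* Let $\alpha^*$ be an optimal solution to $(DSDP)$, and let $$S^*=C+\sum_{k\in K}\alpha^*_kA_k .$$ If $\ell,u\in\mathbb{R}^{2n}$ are defined by $\ell_i=\ell_{i+n}=-V_i^{max}$ and $u_i=u_{i+n}=V_i^{max}$ for $i=1,\dots,n$, then $$\mathtt{v}(SDP)=\max_{S\succeq0}\mathtt{v}(\overline{OPF}_S)=\mathtt{v}(\overline{OPF}_{S^*}),$$ where the maximum is over all positive semidefinite $S\in\mathbb{S}_{2n}(\mathbb{R})$.
   Context: Notation: $\mathbb{S}_m(\mathbb{R})$ is the set of real symmetric $m\times m$ matrices; $\langle A,B\rangle$ is the canonical (trace/Frobenius) scalar product of matrices; $M\succeq 0$ means $M$ is symmetric positive semidefinite; $\mathbf{i}$ is the imaginary unit; $V^*$ is the conjugate transpose of $V$; $\mathtt{v}(P)$ is the optimal value of an optimization problem $(P)$ (infimum for a minimization problem, supremum for a maximization problem). The OPF problem: Let $N=\{1,\dots,n\}$ be the set of nodes of an electric network, partitioned into production nodes $N^G$ and consumption nodes $N^D$. The data are: costs $c_i\in\mathbb{R}$ and real bounds $P_i^{min},P_i^{max},Q_i^{min},Q_i^{max}$ for $i\in N^G$; demands $P_i^D,Q_i^D\in\mathbb{R}$ for $i\in N^D$; for each $i\in N$ a complex $n\times n$ matrix $Y_i$ (admittance matrix at node $i$) and voltage magnitude bounds $0\le V_i^{min}\le V_i^{max}$. The problem is to minimize $\sum_{i\in N^G}c_iP^G_i$ over $V\in\mathbb{C}^n$, $P^G,Q^G\in\mathbb{R}^{N^G}$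 subject to $P^G_i+\mathbf{i}Q^G_i=V^*Y_iV$ for $i\in N^G$; $-P^D_i-\mathbf{i}Q^D_i=V^*Y_iV$ for $i\in N^D$; $P_i^{min}\le P_i^G\le P_i^{max}$ and $Q_i^{min}\le Q_i^G\le Q_i^{max}$ for $i\in N^G$; $(V_i^{min})^2\le|V_i|^2\le(V_i^{max})^2$ for $i\in N$. Eliminating $P^G,Q^G$ and writing $x\in\mathbb{R}^{2n}$ with $x_i$ and $x_{i+n}$ the real and imaginary parts of $V_i$, this is the quadratic program $$(OPF)\qquad \min_{x\in\mathbb{R}^{2n}} x^tCx\quad\text{s.t.}\quad x^tA_kx\le b_k,\ k\in K,$$ where $C,A_k\in\mathbb{S}_{2n}(\mathbb{R})$, $b_k\in\mathbb{R}$, and $K$ is a finite index set with $|K|=6n$. Here $x^tCx=\sum_{i\in N^G}c_i\,\mathrm{Re}(V^*Y_iV)$, and the constraints indexed by $K$ are, for each node $i$: the two voltage magnitude constraints $x_i^2+x_{i+n}^2\le (V_i^{max})^2$ and $-x_i^2-x_{i+n}^2\le-(V_i^{min})^2$; and four inequalities bounding $\mathrm{Re}(V^*Y_iV)$ and $\mathrm{Im}(V^*Y_iV)$ above and below, by $P_i^{max},P_i^{min}$ and $Q_i^{max},Q_i^{min}$ if $i\in N^G$, and by $-P_i^D$ (both sides) and $-Q_i^D$ (both sides) if $i\in N^D$ (an equality being written as two inequalities). The rank relaxation of $(OPF)$ is $$(SDP)\qquad \min_{X\in\mathbb{S}_{2n}(\mathbb{R})}\langle C,X\rangle\quad\text{s.t.}\quad\langle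 A_k,X\rangle\le b_k,\ k\in K,\quad X\succeq0,$$ and its dual is $$(DSDP)\qquad \max_{\alpha\in\mathbb{R}^{|K|}}\ \sum_{k\in K}-b_k\alpha_k\quad\text{s.t.}\quad C+\sum_{k\in K}\alpha_kA_k\succeq0,\quad \alpha_k\ge0,\ k\in K.$$ For a positive semidefinite $S\in\mathbb{S}_{2n}(\mathbb{R})$ and bounds $\ell,u\in\mathbb{R}^{2n}$, the quadratic convex relaxation $(\overline{OPF}_S)$ is the problem $$\min_{x\in\mathbb{R}^{2n},\,Y\in\mathbb{S}_{2n}(\mathbb{R})}\ x^tSx+\langle C-S,Y\rangle$$ subject to $\langle A_k,Y\rangle\le b_k$ for $k\in K$ and the McCormick inequalities, for all $(i,j)\in E=\{(i,j)\in\{1,\dots,2n\}^2: i\le j\}$: $$Y_{ij}\le u_jx_i+\ell_ix_j-\ell_iu_j,\qquad Y_{ij}\le \ell_jx_i+u_ix_j-u_i\ell_j,$$ $$Y_{ij}\ge u_jx_i+u_ix_j-u_iu_j,\qquad Y_{ij}\ge \ell_jx_i+\ell_ix_j-\ell_i\ell_j.$$ *)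

(* Defs.v *)
From HB Require Import structures.
From mathcomp Require Import all_boot all_order all_algebra.
From mathcomp Require Import complex.
From mathcomp Require Import boolp classical_sets reals ereal.
From mathcomp Require Import ring lra.

Set Implicit Arguments.
Unset Strict Implicit.
Unset Printing Implicit Defensive.

Import Order.TTheory GRing.Theory Num.Theory.
Local Open Scope classical_set_scope.
Local Open Scope ring_scope.
Local Open Scope complex_scope.

Section Matrices.
Variable R : realType.

Definition qform m (M : 'M[R]_m) (x : 'cV[R]_m) : R := (x^T *m M *m x) 0 0.

Definition frob m (M N : 'M[R]_m) : R := \tr (M^T *m N).

Definition symmetric m (M : 'M[R]_m) : Prop := M^T = M.

Definition psd m (M : 'M[R]_m) : Prop :=
  symmetric M /\ forall x : 'cV[R]_m, 0 <= qform M x.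

Definition sym_part m (M : 'M[R]_m) : 'M[R]_m := 2^-1 *: (M + M^T).

Definition adjoint m p (M : 'M[R[i]]_(m, p)) : 'M[R[i]]_(p, m) :=
  (map_mx conjc M)^T.

End Matrices.

(* The vector V of C^n whose i-th entry has real part x_i and imaginary part
   x_(i+n); indices i and i+n are [lshift n i] and [rshift n i]. *)
Definition voltage (R : realType) n (x : 'cV[R]_(n + n)) : 'cV[R[i]]_n :=
  \col_i (x (lshift n i) 0 +i* x (rshift n i) 0).

Definition power (R : realType) n (Y : 'M[R[i]]_n) (V : 'cV[R[i]]_n) : R[i] :=
  (adjoint V *m Y *m V) 0 0.

(* The symmetric matrices of the real quadratic forms Re (V^* Y V) and
   Im (V^* Y V): if Y = G + iB and V = a + ib, then
   Y V = (G a - B b) + i (B a + G b) is multiplied on the left by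
   a^T - i b^T. See [qform_reP] and [qform_imP]. *)
Definition re_mx (R : realType) n (Y : 'M[R[i]]_n) : 'M[R]_(n + n) :=
  let G := map_mx (@complex.Re R) Y in
  let B := map_mx (@complex.Im R) Y in
  sym_part (block_mx G (- B) B G).

Definition im_mx (R : realType) n (Y : 'M[R[i]]_n) : 'M[R]_(n + n) :=
  let G := map_mx (@complex.Re R) Y in
  let B := map_mx (@complex.Im R) Y in
  sym_part (block_mx B G (- G) B).

Definition mag_mx (R : realType) n (i : 'I_n) : 'M[R]_(n + n) :=
  delta_mx (lshift n i) (lshift n i) + delta_mx (rshift n i) (rshift n i).

(* The production nodes are those of [gen], the consumption nodes the others.
   [cost], [Pmin], [Pmax], [Qmin], [Qmax] are only used on production nodes,
   and [PD], [QD] only on consumption nodes. *)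
Record network (R : realType) (n : nat) := Network {
  gen : {set 'I_n};
  cost : 'I_n -> R;
  Pmin : 'I_n -> R;
  Pmax : 'I_n -> R;
  Qmin : 'I_n -> R;
  Qmax : 'I_n -> R;
  PD : 'I_n -> R;
  QD : 'I_n -> R;
  admittance : 'I_n -> 'M[R[i]]_n;
  Vmin : 'I_n -> R;
  Vmax : 'I_n -> R;
  Vmin_ge0 : forall i, 0 <= Vmin i;
  Vmin_le_Vmax : forall i, Vmin i <= Vmax i
}.

Inductive quantity := Magnitude | Active | Reactive.

Definition ord_of_quantity (q : quantity) : 'I_3 :=
  match q with Magnitude => inord 0 | Active => inord 1 | Reactive => inord 2 end.

Definition quantity_of_ord (i : 'I_3) : quantity :=
  match val i with 0%N => Magnitude | 1%N => Active | _ => Reactive end.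

Lemma ord_of_quantityK : cancel ord_of_quantity quantity_of_ord.
Proof. by case; rewrite /quantity_of_ord /= inordK. Qed.

HB.instance Definition _ := Finite.copy quantity (can_type ord_of_quantityK).

Lemma card_quantity : #|{: quantity}| = 3%N.
Proof.
rewrite -(card_ord 3); apply: (bij_eq_card (f := ord_of_quantity)).
exists quantity_of_ord; first exact: ord_of_quantityK.
move=> i; apply/val_inj; rewrite /quantity_of_ord.
by case: i => -[|[|[|//]]] ? /=; rewrite inordK.
Qed.

(* The index set K: [(i, q, true)] is the upper bound and [(i, q, false)] the
   lower bound on the quantity q at node i. *)
Notation constr n := ('I_n * quantity * bool)%type.

Lemma card_constr n : #|{: constr n}| = (6 * n)%N.
Proof.
by rewrite !card_prod card_bool card_quantity card_ord -mulnA mulnC.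
Qed.

Section OPF.
Variables (R : realType) (n : nat) (d : network R n).

Definition quantity_mx (i : 'I_n) (q : quantity) : 'M[R]_(n + n) :=
  match q with
  | Magnitude => mag_mx R i
  | Active => re_mx (admittance d i)
  | Reactive => im_mx (admittance d i)
  end.

Definition lower (i : 'I_n) (q : quantity) : R :=
  match q with
  | Magnitude => Vmin d i ^+ 2
  | Active => if i \in gen d then Pmin d i else - PD d i
  | Reactive => if i \in gen d then Qmin d i else - QD d i
  end.

Definition upper (i : 'I_n) (q : quantity) : R :=
  match q with
  | Magnitude => Vmax d i ^+ 2
  | Active => if i \in gen d then Pmax d i else - PD d i
  | Reactive => if i \in gen d then Qmax d i else - QD d i
  end.

Definition C_mx : 'M[R]_(n + n) :=
  \sum_(i in gen d) cost d i *: re_mx (admittance d i).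

Definition A_mx (k : constr n) : 'M[R]_(n + n) :=
  let: (i, q, up) := k in if up then quantity_mx i q else - quantity_mx i q.

Definition b_rhs (k : constr n) : R :=
  let: (i, q, up) := k in if up then upper i q else - lower i q.

Definition sdp_feasible : set 'M[R]_(n + n) :=
  [set X | psd X /\ forall k, frob (A_mx k) X <= b_rhs k].

Definition v_SDP : \bar R :=
  ereal_inf [set (frob C_mx X)%:E | X in sdp_feasible].

Definition dsdp_objective (alpha : {ffun constr n -> R}) : R :=
  \sum_k - b_rhs k * alpha k.

Definition dsdp_feasible : set {ffun constr n -> R} :=
  [set alpha | psd (C_mx + \sum_k alpha k *: A_mx k) /\
               forall k, 0 <= alpha k].

Definition dsdp_optimal (alpha : {ffun constr n -> R}) : Prop :=
  dsdp_feasible alpha /\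
  forall beta, dsdp_feasible beta -> dsdp_objective beta <= dsdp_objective alpha.

Definition mccormick (l u x : 'cV[R]_(n + n)) (Y : 'M[R]_(n + n)) : Prop :=
  forall i j : 'I_(n + n), (i <= j)%N ->
  [/\ Y i j <= u j 0 * x i 0 + l i 0 * x j 0 - l i 0 * u j 0,
      Y i j <= l j 0 * x i 0 + u i 0 * x j 0 - u i 0 * l j 0,
      Y i j >= u j 0 * x i 0 + u i 0 * x j 0 - u i 0 * u j 0 &
      Y i j >= l j 0 * x i 0 + l i 0 * x j 0 - l i 0 * l j 0].

Definition relax_feasible (l u : 'cV[R]_(n + n)) :
    set ('cV[R]_(n + n) * 'M[R]_(n + n)) :=
  [set p | [/\ symmetric p.2,
               forall k, frob (A_mx k) p.2 <= b_rhs k &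
               mccormick l u p.1 p.2]].

Definition v_relax (l u : 'cV[R]_(n + n)) (S : 'M[R]_(n + n)) : \bar R :=
  ereal_inf [set (qform S p.1 + frob (C_mx - S) p.2)%:E |
              p in relax_feasible l u].

End OPF.

Definition is_maximum (R : realType) (E : set (\bar R)) (m : \bar R) : Prop :=
  E m /\ ubound E m.

Section Correctness.
Variable R : realType.

Lemma qformE m (M : 'M[R]_m) x :
  qform M x = \sum_i \sum_j x i 0 * M i j * x j 0.
Proof.
rewrite /qform mxE exchange_big /=; apply: eq_bigr => j _.
by rewrite mxE mulr_suml; apply: eq_bigr => i _; rewrite mxE.
Qed.

Lemma qformD m (M N : 'M[R]_m) x : qform (M + N) x = qform M x + qform N x.
Proof. by rewrite /qform mulmxDr mulmxDl mxE. Qed.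

Lemma qformZ m a (M : 'M[R]_m) x : qform (a *: M) x = a * qform M x.
Proof. by rewrite /qform -scalemxAr -scalemxAl mxE. Qed.

Lemma qformN m (M : 'M[R]_m) x : qform (- M) x = - qform M x.
Proof. by rewrite -scaleN1r qformZ mulN1r. Qed.

Lemma qform_tr m (M : 'M[R]_m) x : qform M^T x = qform M x.
Proof.
rewrite !qformE exchange_big; apply: eq_bigr => i _; apply: eq_bigr => j _.
by rewrite mxE; ring.
Qed.

Lemma qform_sym_part m (M : 'M[R]_m) x : qform (sym_part M) x = qform M x.
Proof. by rewrite qformZ qformD qform_tr; field. Qed.

Lemma sym_part_symmetric m (M : 'M[R]_m) : symmetric (sym_part M).
Proof. by rewrite /symmetric linearZ linearD /= trmxK addrC. Qed.

Variable n : nat.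

Lemma qform_block (M11 M12 M21 M22 : 'M[R]_n) (x : 'cV[R]_(n + n)) :
  qform (block_mx M11 M12 M21 M22) x =
  \sum_i \sum_j
    (x (lshift n i) 0 * M11 i j * x (lshift n j) 0 +
     x (lshift n i) 0 * M12 i j * x (rshift n j) 0 +
     (x (rshift n i) 0 * M21 i j * x (lshift n j) 0 +
      x (rshift n i) 0 * M22 i j * x (rshift n j) 0)).
Proof.
rewrite qformE big_split_ord /= -big_split /=; apply: eq_bigr => i _.
rewrite !big_split_ord /= -!big_split /=; apply: eq_bigr => j _.
by rewrite block_mxEul block_mxEur block_mxEdl block_mxEdr.
Qed.

Lemma powerE (Y : 'M[R[i]]_n) (V : 'cV[R[i]]_n) :
  power Y V = \sum_i \sum_j conjc (V i 0) * Y i j * V j 0.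
Proof.
rewrite /power mxE exchange_big /=; apply: eq_bigr => j _.
by rewrite mxE mulr_suml; apply: eq_bigr => i _; rewrite !mxE.
Qed.

Lemma qform_reP (Y : 'M[R[i]]_n) (x : 'cV[R]_(n + n)) :
  qform (re_mx Y) x = complex.Re (power Y (voltage x)).
Proof.
rewrite /re_mx qform_sym_part qform_block powerE raddf_sum /=.
apply: eq_bigr => i _; rewrite raddf_sum /=; apply: eq_bigr => j _.
by rewrite !mxE; case: (Y i j) => g b /=; ring.
Qed.

Lemma qform_imP (Y : 'M[R[i]]_n) (x : 'cV[R]_(n + n)) :
  qform (im_mx Y) x = complex.Im (power Y (voltage x)).
Proof.
rewrite /im_mx qform_sym_part qform_block powerE raddf_sum /=.
apply: eq_bigr => i _; rewrite raddf_sum /=; apply: eq_bigr => j _.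
by rewrite !mxE; case: (Y i j) => g b /=; ring.
Qed.

Lemma qform_delta m (i : 'I_m) (x : 'cV[R]_m) :
  qform (delta_mx i i) x = x i 0 ^+ 2.
Proof.
rewrite qformE (bigD1 i) //= [X in _ + X]big1 => [|k /negPf ki]; last first.
  by rewrite big1 // => j _; rewrite mxE ki /= mulr0 mul0r.
rewrite addr0 (bigD1 i) //= [X in _ + X]big1 => [|k /negPf ki]; last first.
  by rewrite mxE ki andbF mulr0 mul0r.
by rewrite addr0 mxE !eqxx /= mulr1 expr2.
Qed.

Lemma qform_magP (i : 'I_n) (x : 'cV[R]_(n + n)) :
  qform (mag_mx R i) x = x (lshift n i) 0 ^+ 2 + x (rshift n i) 0 ^+ 2.
Proof. by rewrite qformD !qform_delta. Qed.

Variable d : network R n.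

Lemma C_mx_symmetric : symmetric (C_mx d).
Proof.
rewrite /symmetric /C_mx raddf_sum; apply: eq_bigr => i _.
by rewrite /= linearZ /= sym_part_symmetric.
Qed.

Lemma A_mx_symmetric k : symmetric (A_mx d k).
Proof.
have sQ i q : symmetric (quantity_mx d i q).
  case: q; [|exact: sym_part_symmetric..].
  by rewrite /symmetric /= /mag_mx linearD /= !trmx_delta.
by case: k => -[i q] []; rewrite /symmetric /= ?linearN /= sQ.
Qed.

Lemma qform_CP (x : 'cV[R]_(n + n)) :
  qform (C_mx d) x =
  \sum_(i in gen d) cost d i * complex.Re (power (admittance d i) (voltage x)).
Proof.
transitivity (\sum_(i in gen d) qform (cost d i *: re_mx (admittance d i)) x).
  by rewrite /qform /C_mx mulmx_sumr mulmx_suml summxE.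
by apply: eq_bigr => i _; rewrite qformZ qform_reP.
Qed.

Lemma qp_feasibleP (x : 'cV[R]_(n + n)) :
  (forall k, qform (A_mx d k) x <= b_rhs d k) <->
  (forall i, let s := power (admittance d i) (voltage x) in
   [/\ Vmin d i ^+ 2 <= x (lshift n i) 0 ^+ 2 + x (rshift n i) 0 ^+ 2
         <= Vmax d i ^+ 2,
       i \in gen d -> (Pmin d i <= complex.Re s <= Pmax d i) /\
                      (Qmin d i <= complex.Im s <= Qmax d i) &
       i \notin gen d -> s = (- PD d i) +i* (- QD d i)]).
Proof.
split=> [H i s|H [[i q] up]].
  have Hm := (H (i, Magnitude, true), H (i, Magnitude, false)).
  have Ha := (H (i, Active, true), H (i, Active, false)).
  have Hr := (H (i, Reactive, true), H (i, Reactive, false)).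
  move: Hm Ha Hr.
  rewrite /= !qformN qform_magP qform_reP qform_imP -/s !lerN2.
  move=> [-> ->] [a1 a2] [r1 r2]; split=> // [gi|/negPf gi].
    by move: a1 a2 r1 r2; rewrite gi => -> -> -> ->.
  move: a1 a2 r1 r2; rewrite gi; case: s => p q /= ? ? ? ?.
  by congr (_ +i* _); apply/eqP; rewrite eq_le; apply/andP.
have /= [/andP[m1 m2] g c] := H i.
have [gi|gi] := boolP (i \in gen d).
  have [/andP[p1 p2] /andP[q1 q2]] := g gi.
  by case: q up => -[] /=; rewrite ?qformN ?qform_magP ?qform_reP ?qform_imP
    ?lerN2 ?gi.
have e := c gi.
by case: q up => -[] /=; rewrite ?qformN ?qform_magP ?qform_reP ?qform_imP
  ?lerN2 ?(negPf gi) ?e.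
Qed.

End Correctness.

(* Main.v *)
Require Import Defs.
From mathcomp Require Import all_boot all_order all_algebra.
From mathcomp Require Import boolp classical_sets reals ereal.
From mathcomp Require Import topology normedtype derive realfun.
From mathcomp Require Import ring lra.

(** Write D for the optimal value of the dual program. The result follows from
    the cycle
      v(SDP) <= D <= v(relaxation for S* ) <= v(SDP),
    together with v(relaxation for S) <= v(SDP) for every positive semidefinite
    S, of which the last inequality of the cycle is a case.

    - Any relaxation is below the semidefinite program [relax_le_sdp]. If X is
      feasible for the latter, then (0, X) is feasible for the relaxation: at
      x = 0 the McCormick inequalities reduce to |X_ij| <= u_i u_j, which holds
      because X is positive semidefinite with diagonal entries X_ii <= u_i^2.
      The objective drops by <S, X>, which is nonnegative for positive
      semidefinite S and X [frob_psd_ge0].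

    - D bounds the relaxation for S* from below [dual_le_relax]. Its objective
      is x^T S* x - sum_k alpha_k <A_k, Y>, where the first term is nonnegative
      and the second is at least - sum_k alpha_k b_k = D.

    - Strong duality [sdp_attains_dual]. Constraint qualification comes from the
      upper bounds on the voltage magnitudes, whose matrices add up to the
      identity: they let one shift a dual slack matrix by a multiple of the
      identity at a controlled price. Consider the system <A_k, X> <= b_k,
      <C, X> <= D over the positive semidefinite X with trace at most r. By
      compactness the sum of the squared violations is minimised at some X0; if
      X0 solves the system, it shows v(SDP) <= D. Otherwise the positive parts
      of the violations at X0 are nonnegative multipliers whose combination of
      the inequalities is violated throughout the compact set
      [compact_convex_alternative]. Testing it on the rank-one matrices and
      shifting by the identity makes it hold on the whole cone, and averaging
      the result with alpha gives a dual feasible point of value above D, which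
      is absurd. *)

Set Implicit Arguments.
Unset Strict Implicit.
Unset Printing Implicit Defensive.

(* [symmetric] must denote symmetry of matrices, not of relations. *)
Import Defs.
Import Order.TTheory GRing.Theory Num.Theory.
Import numFieldNormedType.Exports.
Local Open Scope classical_set_scope.
Local Open Scope ring_scope.

(** * The scalar product of matrices and positive semidefiniteness *)

Section Frobenius.
Variables (R : realType) (m : nat).
Implicit Types (M N X : 'M[R]_m) (x : 'cV[R]_m).

Lemma frobE M N : frob M N = \sum_i \sum_j M i j * N i j.
Proof.
rewrite /frob /mxtrace exchange_big; apply: eq_bigr => j _ /=.
by rewrite mxE; apply: eq_bigr => i _; rewrite mxE.
Qed.

Lemma frobC M N : frob M N = frob N M.
Proof.
by rewrite !frobE; apply: eq_bigr => i _; apply: eq_bigr => j _; rewrite mulrC.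
Qed.

Lemma frobDr M N X : frob X (M + N) = frob X M + frob X N.
Proof. by rewrite /frob mulmxDr mxtraceD. Qed.

Lemma frobZr a M X : frob X (a *: M) = a * frob X M.
Proof. by rewrite /frob -scalemxAr mxtraceZ. Qed.

Lemma frobDl M N X : frob (M + N) X = frob M X + frob N X.
Proof. by rewrite frobC frobDr !(frobC X). Qed.

Lemma frobZl a M X : frob (a *: M) X = a * frob M X.
Proof. by rewrite frobC frobZr frobC. Qed.

Lemma frobBl M N X : frob (M - N) X = frob M X - frob N X.
Proof. by rewrite -scaleN1r frobDl frobZl mulN1r. Qed.

Lemma frobBr M N X : frob X (M - N) = frob X M - frob X N.
Proof. by rewrite frobC frobBl !(frobC X). Qed.

Lemma frob_suml (I : finType) (F : I -> 'M[R]_m) X :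
  frob (\sum_i F i) X = \sum_i frob (F i) X.
Proof. by rewrite /frob raddf_sum mulmx_suml raddf_sum. Qed.

Lemma frob1 X : frob 1%:M X = \tr X.
Proof. by rewrite /frob trmx1 mul1mx. Qed.

Lemma frob_delta i j X : frob (delta_mx i j) X = X i j.
Proof.
rewrite frobE (bigD1 i) //= (bigD1 j) //= mxE !eqxx mul1r.
rewrite !big1 ?addr0 // => k /negPf nk; last by rewrite mxE nk andbF mul0r.
by rewrite big1 // => p _; rewrite mxE nk mul0r.
Qed.

Lemma frob_outer M x : frob M (x *m x^T) = qform M x.
Proof.
by rewrite frobC /frob trmx_mul trmxK -mulmxA mxtrace_mulC trace_mx11.
Qed.

Lemma qform0 M : qform M 0 = 0.
Proof. by rewrite /qform mulmx0 mxE. Qed.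

Lemma qform_scale M a x : qform M (a *: x) = a ^+ 2 * qform M x.
Proof.
rewrite /qform; have -> : (a *: x)^T = a *: x^T by rewrite linearZ.
by rewrite -!scalemxAl -scalemxAr !mxE mulrA expr2.
Qed.

Lemma qform_outer x y : qform (x *m x^T) y = ((x^T *m y) 0 0) ^+ 2.
Proof.
rewrite /qform mulmxA -mulmxA mxE big_ord1 expr2; congr (_ * _).
by rewrite -[y^T *m x]trmxK trmx_mul trmxK mxE.
Qed.

Lemma qform1E x : qform 1%:M x = \sum_i x i 0 ^+ 2.
Proof. by rewrite /qform mulmx1 mxE; apply: eq_bigr => i _; rewrite mxE. Qed.

Lemma qform_delta_vec M i : qform M (delta_mx i 0) = M i i.
Proof. by rewrite /qform trmx_delta -rowE -colE !mxE. Qed.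

Lemma symmetric_entry M i j : symmetric M -> M i j = M j i.
Proof. by move=> sM; rewrite -[in LHS]sM mxE. Qed.

Lemma symmetric_comb M N a : symmetric M -> symmetric N ->
  symmetric (M + a *: N).
Proof. by rewrite /symmetric linearD linearZ /= => -> ->. Qed.

Lemma symmetric_sum (I : finType) (F : I -> 'M[R]_m) :
  (forall i, symmetric (F i)) -> symmetric (\sum_i F i).
Proof.
by move=> sF; rewrite /symmetric raddf_sum; apply: eq_bigr => i _; exact: sF.
Qed.

Lemma psd_outer x : psd (x *m x^T).
Proof.
split=> [|y]; first by rewrite /symmetric trmx_mul trmxK.
by rewrite qform_outer sqr_ge0.
Qed.

Lemma psd_comb M N a : 0 <= a -> psd M -> psd N -> psd (M + a *: N).
Proof.
move=> a0 [sM pM] [sN pN]; split=> [|x]; first exact: symmetric_comb.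
by rewrite qformD qformZ addr_ge0 ?mulr_ge0.
Qed.

Lemma psd0 : psd (0 : 'M[R]_m).
Proof.
split=> [|x]; first by rewrite /symmetric trmx0.
by rewrite /qform mulmx0 mul0mx mxE.
Qed.

Lemma psd_diag_ge0 M i : psd M -> 0 <= M i i.
Proof. by case=> _ /(_ (delta_mx i 0)); rewrite qform_delta_vec. Qed.

(** The minimum over t is at t = - b / c; the case c = 0 forces b = 0. *)
Lemma discriminant_le (a b c : R) : 0 <= c ->
  (forall t, 0 <= a + 2 * t * b + t ^+ 2 * c) -> b ^+ 2 <= a * c.
Proof.
rewrite le_eqVlt => /predU1P[<- H|c0 H].
  have [->|b0] := eqVneq b 0; first by rewrite mulr0 expr0n.
  (* this t makes the affine function a + 2 t b equal to -1 *)
  have := H (- (a + 1) / (2 * b)).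
  suff -> : a + 2 * (- (a + 1) / (2 * b)) * b + (- (a + 1) / (2 * b)) ^+ 2 * 0
     = -1 by rewrite ler0N1.
  by field.
have := H (- b / c).
have -> : a + 2 * (- b / c) * b + (- b / c) ^+ 2 * c = (a * c - b ^+ 2) / c.
  by field; rewrite gt_eqF.
by rewrite pmulr_lge0 ?invr_gt0 // subr_ge0.
Qed.

(** Nonnegativity of the quadratic form along the line x + t e_i bounds the
    discriminant in t. *)
Lemma psd_cauchy_schwarz M x i : psd M ->
  (M *m x) i 0 ^+ 2 <= qform M x * M i i.
Proof.
move=> pM; apply: discriminant_le; first exact: psd_diag_ge0.
move=> t; have [sM /(_ (x + t *: delta_mx i 0))] := pM.
suff -> : qform M (x + t *: delta_mx i 0) =
    qform M x + 2 * t * (M *m x) i 0 + t ^+ 2 * M i i by [].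
rewrite {1}/qform.
have -> : (x + t *: delta_mx i 0)^T = x^T + t *: delta_mx 0 i.
  by rewrite linearD linearZ /= trmx_delta.
rewrite mulmxDl mulmxDr !mulmxDl -!scalemxAr -!scalemxAl -!rowE.
have -> : x^T *m M *m delta_mx i 0 = ((M *m x) i 0)%:M.
  rewrite -colE; apply/matrixP => p q; rewrite !ord1 !mxE mulr1n.
  by apply: eq_bigr => j _; rewrite mxE (symmetric_entry _ _ sM) mulrC.
have -> : row i M *m x = ((M *m x) i 0)%:M.
  by rewrite -row_mul; apply/matrixP => p q; rewrite !ord1 !mxE mulr1n.
rewrite -/(qform M x) -colE; move: ((M *m x) i 0) => b.
by rewrite !(mxE, mulr1n) /qform !mxE /=; ring.
Qed.

Lemma psd_entry_sqr M i j : psd M -> M i j ^+ 2 <= M i i * M j j.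
Proof.
move=> pM; have := psd_cauchy_schwarz (delta_mx j 0) i pM.
by rewrite -colE mxE qform_delta_vec mulrC.
Qed.

Lemma psd_entry_le M i j (a b : R) : psd M -> 0 <= a -> 0 <= b ->
  M i i <= a ^+ 2 -> M j j <= b ^+ 2 -> `|M i j| <= a * b.
Proof.
move=> pM a0 b0 ia jb; rewrite -(ler_pXn2r (ltn0Sn 1)) ?nnegrE ?mulr_ge0 //.
rewrite real_normK ?num_real // exprMn (le_trans (psd_entry_sqr _ _ pM)) //.
by rewrite ler_pM // psd_diag_ge0.
Qed.

(** The Schur complement, kept at full size: what remains is nonnegative by
    Cauchy-Schwarz, and its i-th diagonal entry vanishes. *)
Lemma psd_deflate M i : psd M -> 0 < M i i ->
  psd (M - (M i i)^-1 *: (col i M *m (col i M)^T)).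
Proof.
move=> pM Mi; have [sM _] := pM; split=> [|x].
  by rewrite -scaleNr; apply: symmetric_comb => //; case: (psd_outer (col i M)).
rewrite qformD qformN qformZ qform_outer subr_ge0.
rewrite ler_pdivrMl // mulrC.
have -> : (col i M)^T *m x = row i (M *m x).
  by rewrite row_mul tr_col sM.
by rewrite mxE psd_cauchy_schwarz.
Qed.

(** Subtracting rank-one terms c c^T from N, each of which contributes a
    nonnegative multiple of c^T M c, exhausts N: every deflation removes one
    nonzero diagonal entry and creates none. *)
Lemma frob_psd_ge0 M N : psd M -> psd N -> 0 <= frob M N.
Proof.
move=> pM; have [k] := ubnP #|[set i | N i i != 0]|%SET.
elim: k N => // k IH N; rewrite ltnS => cN pN.
have [[i Ni]|N0] := pselect (exists i, N i i != 0); last first.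
  (* a zero diagonal forces N = 0 since N_ij^2 <= N_ii N_jj *)
  suff -> : N = 0 by rewrite frobE big1 // => i _; rewrite big1 // => j _;
    rewrite mxE mulr0.
  apply/matrixP => i j; rewrite mxE; apply/eqP; rewrite -sqrf_eq0.
  rewrite eq_le sqr_ge0 andbT (le_trans (psd_entry_sqr _ _ pN)) //.
  have [->|Ni] := eqVneq (N i i) 0; first by rewrite mul0r.
  by case: N0; exists i.
have Ni0 : 0 < N i i by rewrite lt_def Ni psd_diag_ge0.
set c := col i N; pose N' := N - (N i i)^-1 *: (c *m c^T).
have N'E j : N' j j = N j j - (N i i)^-1 * N j i ^+ 2.
  by rewrite !mxE big_ord1 !mxE expr2.
have -> : N = N' + (N i i)^-1 *: (c *m c^T) by rewrite subrK.
rewrite frobDr frobZr frob_outer.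
rewrite addr_ge0 ?mulr_ge0 ?invr_ge0 ?(ltW Ni0) //; last by case: pM.
apply: IH; last exact: psd_deflate.
apply: leq_trans cN; apply: proper_card; apply/properP; split.
  apply/fintype.subsetP => j; rewrite !inE; apply: contraNneq => Nj.
  rewrite N'E Nj; suff /eqP -> : N j i ^+ 2 == 0 by rewrite mulr0 subr0.
  rewrite eq_le sqr_ge0 andbT; have := psd_entry_sqr j i pN.
  by rewrite Nj mul0r.
exists i; rewrite !inE ?Ni // negbK N'E.
by apply/eqP; field; rewrite gt_eqF.
Qed.

End Frobenius.

(** * Compact convex sets of matrices *)

Section Compactness.
Variable R : realType.

Lemma vec_mx_continuous m n : continuous (@vec_mx R m n).
Proof.
move=> v s /= /nbhs_ballP[e e0 es]; apply/nbhs_ballP; exists e => //= w [_ vw].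
by apply: es; split=> // i j; rewrite !mxE; exact: vw.
Qed.

(** Heine-Borel for matrices, transported from row vectors along [vec_mx]. *)
Lemma bounded_closed_mx_compact m n (A : set 'M[R]_(m, n)) (r : R) :
  (forall X i j, A X -> `|X i j| <= r) -> closed A -> compact A.
Proof.
move=> Ar cA.
have -> : A = vec_mx @` (vec_mx @^-1` A).
  apply/seteqP; split=> [X AX|_ [v Av <-]] //=.
  by exists (mxvec X); rewrite /= mxvecK.
apply: continuous_compact; first exact/continuous_subspaceT/vec_mx_continuous.
apply: bounded_closed_compact; last first.
  by apply: preimage_closed => // v _; exact: vec_mx_continuous.
(* the absolute value keeps the bound valid for matrices without entries *)
exists `|r|; split=> [|s rs v Av]; first exact: num_real.
rewrite /globally /= [`|v|]/Num.norm /= mx_normrE.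
apply: bigmax_le => [|[i k] _ /=].
  by rewrite (le_trans _ (ltW rs)).
case/mxvec_indexP: k => j p; rewrite ord1; have := Ar _ j p Av; rewrite mxE.
by move=> /le_trans; apply; exact: le_trans (ler_norm r) (ltW rs).
Qed.

Variable m : nat.

Lemma continuous_sum (T : topologicalType) (I : finType) (F : I -> T -> R) :
  (forall i, continuous (F i)) -> continuous (fun x => \sum_i F i x).
Proof.
by move=> cF x; apply: (cvg_big (@add_continuous R)) => i _; exact: cF.
Qed.

Lemma frob_continuous (M : 'M[R]_m) : continuous (frob M).
Proof.
have -> : frob M = (fun X => \sum_i \sum_j M i j * X i j).
  by apply/funext => X; rewrite frobE.
apply: continuous_sum => i; apply: continuous_sum => j X.
by apply: continuousM; [exact: cst_continuous|exact: coord_continuous].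
Qed.

Lemma closed_frob_le (M : 'M[R]_m) (c : R) :
  closed [set X : 'M[R]_m | frob M X <= c].
Proof.
have H : {in ~` frob M @^-1` [set x | x <= c], continuous (frob M)}.
  by move=> X _; exact: frob_continuous.
exact: (preimage_closed H (@closed_le _ c)).
Qed.

(** Closedness comes from writing the set as an intersection of half-spaces of
    the form <M, X> <= c; boundedness from X_ij^2 <= X_ii X_jj <= r^2. *)
Lemma compact_psd_trace (r : R) :
  compact [set X : 'M[R]_m | psd X /\ \tr X <= r].
Proof.
apply: (@bounded_closed_mx_compact _ _ _ r).
  move=> X i j [pX Xr].
  have d0 k : 0 <= X k k by exact: psd_diag_ge0.
  have dr k : X k k <= r.
    by apply: le_trans Xr; rewrite /mxtrace (bigD1 k) //= lerDl sumr_ge0.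
  have r0 : 0 <= r := le_trans (d0 i) (dr i).
  have := @psd_entry_le R m X i j (Num.sqrt r) (Num.sqrt r) pX.
  by rewrite -expr2 !sqr_sqrtr //; apply => //; rewrite ?sqrtr_ge0.
have -> : [set X : 'M[R]_m | psd X /\ \tr X <= r] =
   (\bigcap_(ij in [set: 'I_m * 'I_m])
      [set X | frob (delta_mx ij.1 ij.2 - delta_mx ij.2 ij.1) X <= 0]) `&`
   (\bigcap_(y in [set: 'cV[R]_m]) [set X | frob (- (y *m y^T)) X <= 0]) `&`
   [set X | frob 1%:M X <= r].
  have qE y X : (frob (- (y *m y^T)) X <= 0) = (0 <= qform X y).
    by rewrite -scaleN1r frobZl frobC frob_outer mulN1r oppr_le0.
  apply/seteqP; split=> X /= [].
    move=> [sX pX] Xr; rewrite frob1; split=> //; split=> [[i j] _ /=|y _ /=].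
      by rewrite frobBl !frob_delta (symmetric_entry i j sX) subrr.
    by rewrite qE.
  move=> [sX pX]; rewrite frob1 => Xr; split=> //; split=> [|y].
    apply/matrixP => i j; rewrite mxE; apply/eqP; rewrite eq_le.
    have := (sX (i, j) I, sX (j, i) I).
    by rewrite /= !frobBl !frob_delta !subr_le0 => -[-> ->].
  by rewrite -qE; exact: pX.
apply: closedI; last exact: closed_frob_le.
by apply: closedI; apply: closed_bigI => ? _; exact: closed_frob_le.
Qed.

End Compactness.

Section Alternative.
Variables (R : realType) (m : nat).

(** The squared positive part has derivative 2 max(0, a) and curvature at
    most 2. *)
Lemma max0_sqr_step (a t h : R) :
  Num.max 0 (a + t * h) ^+ 2 <=
  Num.max 0 a ^+ 2 + 2 * t * (h * Num.max 0 a) + t ^+ 2 * h ^+ 2.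
Proof.
have -> : t ^+ 2 * h ^+ 2 = (t * h) ^+ 2 by rewrite exprMn.
have -> : 2 * t * (h * Num.max 0 a) = 2 * (t * h) * Num.max 0 a by ring.
move: (t * h) => s.
have sq x : 0 <= x ^+ 2 :> R by exact: sqr_ge0.
case: (lerP 0 a) => a0; case: (lerP 0 (a + s)) => as0; rewrite ?expr0n /=.
- by nra.
- by have := sq (a + s); nra.
- by nra.
- by have := sq s; nra.
Qed.

(** Divide by t and let t tend to 0. *)
Lemma slope_ge0 (L Q : R) : 0 <= Q ->
  (forall t, 0 < t <= 1 -> 0 <= 2 * t * L + t ^+ 2 * Q) -> 0 <= L.
Proof.
move=> Q0 H; rewrite leNgt; apply/negP => L0.
(* small enough that 2 L + t Q < L < 0, and at most 1 *)
pose t := - L / (Q + 1 - L).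
have d0 : 0 < Q + 1 - L by lra.
have tE : t * (Q + 1 - L) = - L by rewrite /t; field; rewrite gt_eqF.
have t0 : 0 < t by rewrite divr_gt0 // oppr_gt0.
have t1 : t <= 1 by rewrite ler_pdivrMr //; lra.
have := H t; rewrite t0 t1 => /(_ isT).
have -> : 2 * t * L + t ^+ 2 * Q = t * (2 * L + t * Q) by ring.
rewrite pmulr_rge0 //; nra.
Qed.

(** A theorem of the alternative for linear inequalities over a compact convex
    set, obtained without a separating hyperplane: the multipliers are the
    positive parts of the violations at a minimiser of their sum of squares. *)
Lemma compact_convex_alternative (K : set 'M[R]_m) (I : finType)
    (B : I -> 'M[R]_m) (e : I -> R) :
  K !=set0 -> compact K ->
  (forall X Y t, K X -> K Y -> 0 < t <= 1 -> K (X + t *: (Y - X))) ->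
  (exists2 X, K X & forall i, frob (B i) X <= e i) \/
  (exists2 a : I -> R, (forall i, 0 <= a i) &
     forall X, K X -> 0 < \sum_i a i * (frob (B i) X - e i)).
Proof.
move=> K0 cK convK.
pose v X i := frob (B i) X - e i.
pose g X := \sum_i Num.max 0 (v X i) ^+ 2.
have cg : continuous g.
  apply: continuous_sum => i X.
  apply: (@continuous_comp _ _ _ (fun X => Num.max 0 (v X i)) (fun x => x ^+ 2)).
    apply: (@continuous_max _ _ (fun=> 0) (fun X => v X i)).
      exact: cst_continuous.
    by apply: continuousB; [exact: frob_continuous|exact: cst_continuous].
  exact: exprn_continuous.
have [X /set_mem KX Xmin] := compact_EVT_min K0 cK (continuous_subspaceT cg).
have [|nX] := pselect (forall i, v X i <= 0).
  by move=> vX; left; exists X => // i; rewrite -subr_le0; exact: vX.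
have {}nX : exists i, 0 < v X i.
  apply: contrapT => H; apply: nX => i; rewrite leNgt; apply/negP => vi.
  by apply: H; exists i.
right; exists (fun i => Num.max 0 (v X i)) => [i|Y KY].
  by rewrite le_max lexx.
set a := fun i => Num.max 0 (v X i).
(* first-order optimality of X in the direction of Y *)
have slope : 0 <= \sum_i (v Y i - v X i) * a i.
  apply: (@slope_ge0 _ (\sum_i (v Y i - v X i) ^+ 2)).
    by rewrite sumr_ge0 // => i _; exact: sqr_ge0.
  move=> t t01; have := Xmin _ (mem_set (convK X Y t KX KY t01)).
  rewrite -subr_ge0 => /le_trans; apply.
  rewrite lerBlDl !mulr_sumr -!big_split /= ler_sum // => i _.
  rewrite addrA.
  have -> : v (X + t *: (Y - X)) i = v X i + t * (v Y i - v X i).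
    by rewrite /v frobDr frobZr frobBr; ring.
  exact: max0_sqr_step.
have ->: \sum_i a i * (frob (B i) Y - e i) =
    \sum_i (v Y i - v X i) * a i + \sum_i v X i * a i.
  by rewrite -big_split; apply: eq_bigr => i _ /=; rewrite /v; ring.
apply: ltr_wpDl => //.
(* only the violated inequalities have a nonzero multiplier *)
have va i : v X i * a i = a i ^+ 2.
  by rewrite /a; case: (ltP 0 (v X i)) => ?; rewrite ?mulr0 ?expr0n.
have [i vi] := nX.
rewrite (bigD1 i) //= ltr_wpDr ?va //.
  by rewrite sumr_ge0 // => j _; rewrite va sqr_ge0.
by rewrite exprn_gt0 // /a lt_max vi orbT.
Qed.

End Alternative.

(** * Semidefinite strong duality *)

Lemma big_option (V : nmodType) (I : finType) (F : option I -> V) :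
  \sum_o F o = F None + \sum_i F (Some i).
Proof.
rewrite (bigD1 None) //=; congr (_ + _).
rewrite (reindex_omap Some id) /= => [|[]//].
by apply: eq_bigl => i; rewrite eqxx.
Qed.

Section Duality.
Variables (R : realType) (m : nat).

(** A quadratic form bounded below by - c on the ball of squared radius r is,
    by homogeneity, at least - (c / r) |x|^2 everywhere. This replaces a bound
    on the least eigenvalue. *)
Lemma psd_from_ball (M : 'M[R]_m) (r c : R) : symmetric M -> 0 < r -> 0 <= c ->
  (forall x, qform 1%:M x <= r -> - c < qform M x) -> psd (M + (c / r) *: 1%:M).
Proof.
move=> sM r0 c0 H; split=> [|x].
  by apply: symmetric_comb; rewrite // /symmetric trmx1.
rewrite qformD qformZ; set q := qform 1%:M x.
have q0 : 0 <= q by rewrite /q qform1E sumr_ge0 // => i _; exact: sqr_ge0.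
have [q0E|q_neq0] := eqVneq q 0.
  have -> : x = 0.
    apply/matrixP => i j; rewrite ord1 mxE; apply/eqP; rewrite -sqrf_eq0.
    move: q0E; rewrite /q qform1E => /eqP; rewrite psumr_eq0 => [|k _].
      by move=> /allP/(_ i (mem_index_enum i)).
    exact: sqr_ge0.
  by rewrite qform0 q0E mulr0 addr0.
have qpos : 0 < q by rewrite lt_def q_neq0.
pose s := Num.sqrt (r / q).
have s2 : s ^+ 2 = r / q by rewrite sqr_sqrtr // divr_ge0 // ltW.
have := H (s *: x); rewrite !qform_scale s2 -/q.
rewrite divfK // lexx => /(_ isT) /ltW h.
have -> : qform M x + c / r * q = (r / q * qform M x + c) * (q / r).
  by field; rewrite !gt_eqF.
by rewrite mulr_ge0 ?divr_ge0 ?(ltW r0) //; lra.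
Qed.

Variables (K : finType) (C : 'M[R]_m) (A : K -> 'M[R]_m) (b : K -> R).

Definition dual_feasible (a : K -> R) : Prop :=
  psd (C + \sum_k a k *: A k) /\ forall k, 0 <= a k.

(** The multipliers beta that combine the A_k into the identity bound the trace
    of feasible matrices by T = sum_k b_k beta_k, and let a dual slack matrix be
    shifted by mu times the identity at the price mu T. *)
Lemma sdp_attains_dual (alpha beta : K -> R) :
  symmetric C -> (forall k, symmetric (A k)) ->
  (forall k, 0 <= beta k) -> \sum_k beta k *: A k = 1%:M ->
  dual_feasible alpha ->
  (forall a, dual_feasible a ->
     \sum_k - b k * a k <= \sum_k - b k * alpha k) ->
  exists X, [/\ psd X, forall k, frob (A k) X <= b k &
                frob C X <= \sum_k - b k * alpha k].
Proof.
move=> sC sA beta0 betaA [pS alpha0] alpha_max.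
set D := \sum_k - b k * alpha k.
(* A trace bound r > T makes that price smaller than the gain - c below; the
   absolute value ensures r > 0. *)
pose T := \sum_k b k * beta k; pose r := `|T| + 1.
have Tr : T < r by rewrite (le_lt_trans (ler_norm T)) // ltrDl.
have r0 : 0 < r by rewrite ltr_wpDl.
pose B (o : option K) := if o is Some k then A k else C.
pose e o := if o is Some k then b k else D.
(* The inequalities of the system are indexed by [option K], with [None] for
   the bound on the objective. *)
have [] := @compact_convex_alternative R m
    [set X | psd X /\ \tr X <= r] _ B e _ (@compact_psd_trace R m r).
- by exists 0; split; [exact: psd0|rewrite mxtrace0 ltW].
- move=> X Y t [pX Xr] [pY Yr] /andP[t0 t1].
  have -> : X + t *: (Y - X) = (1 - t) *: X + t *: Y.
    by rewrite scalerBl scalerBr scale1r addrA addrAC.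
  split.
    apply: psd_comb => //; first exact: ltW.
    by rewrite -[_ *: X]add0r; apply: psd_comb => //; [lra|exact: psd0].
  rewrite mxtraceD !mxtraceZ.
  have -> : r = (1 - t) * r + t * r by ring.
  by rewrite lerD // ler_wpM2l //; lra.
- move=> [X [pX _] HX]; exists X; split=> // [k|].
    exact: (HX (Some k)).
  exact: (HX None).
move=> [a a0 aK]; exfalso.
pose g := a None; pose M := g *: C + \sum_k a (Some k) *: A k.
pose c := \sum_k a (Some k) * b k + g * D.
have aE X : \sum_o a o * (frob (B o) X - e o) = frob M X - c.
  rewrite big_option /= /M /c frobDl frobZl frob_suml mulrBr -/g.
  under eq_bigr do rewrite mulrBr.
  rewrite sumrB; under [X in _ = _ + X - _]eq_bigr do rewrite frobZl.
  by ring.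
have sumA : symmetric (\sum_k a (Some k) *: A k).
  by apply: symmetric_sum => k; rewrite /symmetric linearZ /= (sA k).
have sM : symmetric M by rewrite /symmetric linearD linearZ /= sC sumA.
have MK X : psd X -> \tr X <= r -> c < frob M X.
  by move=> pX Xr; rewrite -subr_gt0 -aE aK.
have c0 : c < 0.
  have := MK 0 (psd0 _ _); rewrite mxtrace0 (ltW r0) => /(_ isT).
  by rewrite /frob mulmx0 mxtrace0.
have pM : psd (M + (- c / r) *: 1%:M).
  apply: psd_from_ball => // [|x xr]; first by rewrite oppr_ge0 ltW.
  rewrite opprK -frob_outer; apply: MK; first exact: psd_outer.
  by rewrite -frob1 frob_outer.
pose mu := - c / r.
have mu0 : 0 <= mu by rewrite divr_ge0 ?oppr_ge0 // ltW.
have g0 : 0 <= g by exact: a0.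
(* M + mu I is the slack matrix of g times the objective; adding that of alpha
   and dividing by 1 + g also covers the case g = 0. *)
pose h := (1 + g)^-1.
have h0 : 0 < h by rewrite invr_gt0; lra.
have hg : h * (1 + g) = 1 by rewrite mulVf // gt_eqF //; lra.
pose a' k := h * (alpha k + a (Some k) + mu * beta k).
have a'_feasible : dual_feasible a'.
  split=> [|k]; last first.
    apply: mulr_ge0; first exact: ltW.
    by apply: addr_ge0; [exact: addr_ge0|exact: mulr_ge0].
  have -> : C + \sum_k a' k *: A k =
      0 + h *: ((C + \sum_k alpha k *: A k) + 1 *: (M + mu *: 1%:M)).
    rewrite add0r scale1r -betaA scaler_sumr /M.
    have -> : C + \sum_k a' k *: A k = (h * (1 + g)) *: C + h *:
       (\sum_k alpha k *: A k + \sum_k a (Some k) *: A k +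
        \sum_k mu *: (beta k *: A k)).
      rewrite hg scale1r -!big_split /= scaler_sumr; congr (_ + _).
      by apply: eq_bigr => k _; rewrite !scalerA -!scalerDl scalerA.
    rewrite -scalerA -scalerDr scalerDl scale1r; congr (_ *: _).
    by rewrite -!addrA; congr (_ + _); exact: addrCA.
  apply: psd_comb; [exact: ltW|exact: psd0|].
  by apply: psd_comb.
have := alpha_max _ a'_feasible; rewrite -/D.
have -> : \sum_k - b k * a' k =
    h * (D - \sum_k a (Some k) * b k - mu * T).
  rewrite /D /T !mulr_sumr -!sumrB mulr_sumr.
  by apply: eq_bigr => k _; rewrite /a'; ring.
have -> : D - \sum_k a (Some k) * b k - mu * T = D * (1 + g) - (c + mu * T).
  by rewrite /c; ring.
rewrite mulrBr mulrCA hg mulr1 leNgt ltrDl oppr_gt0.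
rewrite pmulr_rlt0 //.
have -> : c + mu * T = c * ((r - T) / r) by rewrite /mu; field; rewrite gt_eqF.
by rewrite nmulr_rlt0 // divr_gt0 // subr_gt0.
Qed.

End Duality.

(** * Power flow relaxations *)

Section Relaxations.
Variables (R : realType) (n : nat) (d : network R n).

Lemma sum_mag_mx : \sum_i mag_mx R i = 1%:M :> 'M[R]_(n + n).
Proof.
apply/matrixP => p q; rewrite summxE mxE.
have <- : \sum_(i < n + n) (delta_mx i i : 'M[R]_(n + n)) p q = (p == q)%:R.
  rewrite (bigD1 p) //= mxE eqxx /= big1 ?addr0 1?eq_sym // => i /negPf ip.
  by rewrite mxE eq_sym ip.
rewrite big_split_ord /= -big_split /=; apply: eq_bigr => i _.
by rewrite mxE.
Qed.

(** The squared magnitudes of the voltages add up to |x|^2, so these multipliers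
    combine the constraint matrices into the identity. *)
Definition magnitude_multiplier (k : constr n) : R :=
  (k == (k.1.1, Magnitude, true))%:R.

Lemma magnitude_multiplierP :
  \sum_k magnitude_multiplier k *: A_mx d k = 1%:M.
Proof.
rewrite -sum_mag_mx.
rewrite [LHS](bigID (fun k : constr n => k == (k.1.1, Magnitude, true))) /=.
rewrite [X in _ + X]big1 => [|k /negPf nk]; last first.
  by rewrite /magnitude_multiplier nk scale0r.
rewrite addr0 (reindex_onto (fun i => (i, Magnitude, true)) (fun k => k.1.1)) /=.
  apply: eq_big => [i|i _]; first by rewrite !eqxx.
  by rewrite /magnitude_multiplier eqxx scale1r.
by move=> k /eqP ->.
Qed.

(** Strong duality applies because the magnitude bounds supply multipliers that
    combine the constraint matrices into the identity. *)
Lemma sdp_le_dual (alpha : {ffun constr n -> R}) :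
  dsdp_optimal d alpha -> (v_SDP d <= (dsdp_objective d alpha)%:E)%E.
Proof.
move=> [[pS alpha0] alpha_max].
have [||||||X [pX XA XC]] := @sdp_attains_dual R (n + n) (constr n) (C_mx d)
  (A_mx d) (b_rhs d) alpha magnitude_multiplier.
- exact: C_mx_symmetric.
- exact: A_mx_symmetric.
- by move=> k; rewrite ler0n.
- exact: magnitude_multiplierP.
- by split.
- move=> a [pa a0].
  have aE k : [ffun k => a k] k = a k by rewrite ffunE.
  have := alpha_max [ffun k => a k].
  rewrite /dsdp_objective; under eq_bigr do rewrite aE.
  apply; split=> [|k]; last by rewrite aE.
  by under eq_bigr do rewrite aE.
apply: (@le_trans _ _ (frob (C_mx d) X)%:E); last by rewrite lee_fin.
by apply: ereal_inf_lbound; exists X.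
Qed.

(** Weak duality: the quadratic term of the objective is nonnegative, and
    Y enters through the combination of the constraints with weights alpha. *)
Lemma dual_le_relax (l u : 'cV[R]_(n + n)) (alpha : {ffun constr n -> R}) :
  dsdp_feasible d alpha ->
  ((dsdp_objective d alpha)%:E <=
   v_relax d l u (C_mx d + \sum_k alpha k *: A_mx d k))%E.
Proof.
move=> [[_ pS] alpha0]; apply/ereal_infP => _ [[x Y] [_ /= YA _] <-].
rewrite lee_fin opprD addrA subrr sub0r -[leLHS]add0r lerD //.
rewrite -scaleN1r frobZl mulN1r frob_suml -sumrN ler_sum // => k _.
by rewrite frobZl mulNr lerN2 mulrC ler_wpM2r.
Qed.

Lemma sdp_diag_le X (i : 'I_n) : sdp_feasible d X ->
  X (lshift n i) (lshift n i) <= Vmax d i ^+ 2 /\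
  X (rshift n i) (rshift n i) <= Vmax d i ^+ 2.
Proof.
move=> [pX /(_ (i, Magnitude, true))] /=.
rewrite /mag_mx frobDl !frob_delta => h.
have := (psd_diag_ge0 (lshift n i) pX, psd_diag_ge0 (rshift n i) pX).
by case=> ? ?; split; lra.
Qed.

(** If X is feasible for the semidefinite program then (0, X) is feasible for
    the relaxation, and <S, X> >= 0 is what the objective loses there. *)
Lemma relax_le_sdp (l u : 'cV[R]_(n + n)) (S : 'M[R]_(n + n)) :
  (forall i : 'I_n, l (lshift n i) 0 = - Vmax d i /\
                    l (rshift n i) 0 = - Vmax d i) ->
  (forall i : 'I_n, u (lshift n i) 0 = Vmax d i /\
                    u (rshift n i) 0 = Vmax d i) ->
  psd S -> (v_relax d l u S <= v_SDP d)%E.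
Proof.
move=> hl hu pS; apply/ereal_infP => _ [X fX <-].
have [pX XA] := fX; have [sX _] := pX.
apply: (@le_trans _ _ (qform S 0 + frob (C_mx d - S) X)%:E); last first.
  by rewrite lee_fin qform0 add0r frobBl gerBl frob_psd_ge0.
apply: ereal_inf_lbound; exists (0, X) => //; split=> //= i j _.
have bnd k : [/\ 0 <= u k 0, l k 0 = - u k 0 & X k k <= u k 0 ^+ 2].
  have V0 p : 0 <= Vmax d p := le_trans (Vmin_ge0 d p) (Vmin_le_Vmax d p).
  case: (split_ordP k) => p ->; have [Xl Xr] := sdp_diag_le p fX;
    have [l1 l2] := hl p; have [u1 u2] := hu p;
    by rewrite ?l1 ?l2 ?u1 ?u2.
have [ui li Xi] := bnd i; have [uj lj Xj] := bnd j.
have := psd_entry_le pX ui uj Xi Xj; rewrite ler_norml => /andP[X1 X2].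
by rewrite li lj !mxE; split; lra.
Qed.

End Relaxations.

Theorem proposition2 (R : realType) (n : nat) (d : network R n)
  (alpha : {ffun constr n -> R}) (halpha : dsdp_optimal d alpha)
  (Sstar : 'M[R]_(n + n))
  (hSstar : Sstar = C_mx d + \sum_(k : constr n) alpha k *: A_mx d k)
  (l u : 'cV[R]_(n + n))
  (hl : forall i : 'I_n, l (lshift n i) 0 = - Vmax d i /\
                         l (rshift n i) 0 = - Vmax d i)
  (hu : forall i : 'I_n, u (lshift n i) 0 = Vmax d i /\
                         u (rshift n i) 0 = Vmax d i) :
  is_maximum [set v_relax d l u S | S in [set S : 'M[R]_(n + n) | psd S]]
             (v_SDP d) /\
  v_SDP d = v_relax d l u Sstar.
Proof.
have [fa _] := halpha; have pS : psd Sstar by rewrite hSstar; case: fa.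
have E : v_SDP d = v_relax d l u Sstar.
  apply/eqP; rewrite eq_le (relax_le_sdp hl hu pS) andbT hSstar.
  exact: le_trans (sdp_le_dual halpha) (dual_le_relax l u fa).
split=> //; split; first by exists Sstar.
by move=> _ [S pS' <-]; exact: relax_le_sdp.
Qed.
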